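(* There exist complete Shidoku symmetry groups of minimal order $192$. That is, there exist subgroups $G' \le G_4 = H_4\times S_4$ with $|G'| = 192$ that are complete, and $192$ is the minimum possible order of a complete subgroup of $G_4$.
   Context: A Shidoku board is a $4\times 4$ array with entries in $\{1,2,3,4\}$ such that each row, each column, and each of the four $2\times 2$ corner blocks (rows $\{1,2\}$ or $\{3,4\}$, columns $\{1,2\}$ or $\{3,4\}$) contains each of $1,2,3,4$ exactly once. Let $\mathcal{S}$ be the set of Shidoku boards; $|\mathcal{S}| = 288$. Number the cells $1,\dots,16$ from left to right and then top to bottom and write a board as $B=(b_1,\dots,b_{16})$. A permutation $x\in S_{16}$ acts on boards by moving the value $b_i$ in cell $i$ to cell $x(i)$. The position symmetry group $H_4\le S_{16}$ is the group of all cell permutations that send every Shidoku board to a Shidoku board. It has order $128$ and is generated by $r$ (rotation of the board by a quarter turn clockwise), $s$ (swap of the third and fourth rows), and $t$ (transpose of the board). The group $S_4$ acts on $\mathcal{S}$ by relabeling: $\sigma\in S_4$ replaces each entry $b_i$ by $\sigma(b_i)$. The two actions commute, and the full Shidoku symmetry group is $G_4=H_4\times S_4$, acting on $\mathcal{S}$. It has exactly two orbits on $\mathcal{S}$, one of size $96$ (Type 1 boards) and one of size $192$ (Type 2 boards). A group of Shidoku symmetries (subgroup $G'\le G_4$) is called complete if its orbits on $\mathcal{S}$ are exactly the two orbits of $G_4$. *)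

(* Defs.v *)
From mathcomp Require Import all_boot all_fingroup.

Set Implicit Arguments.
Unset Strict Implicit.
Unset Printing Implicit Defensive.

Local Open Scope group_scope.

(* Cells are numbered from 0 to 15, left to right and then top to bottom, so  *)
(* that cell k lies in row k %/ 4 and column k %% 4.  The symbols 1, 2, 3, 4  *)
(* are represented by the elements 0, 1, 2, 3 of 'I_4.                        *)
Definition cell := 'I_16.
Definition array := {ffun cell -> 'I_4}.

Definition row_cells (i : 'I_4) : {set cell} := [set k : cell | k %/ 4 == i].
Definition column_cells (j : 'I_4) : {set cell} := [set k : cell | k %% 4 == j].
Definition block_cells (a b : 'I_2) : {set cell} :=
  [set k : cell | (k %/ 4 %/ 2 == a) && (k %% 4 %/ 2 == b)].

Definition each_once (B : array) (U : {set cell}) : bool :=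
  [forall v : 'I_4, #|[set k in U | B k == v]| == 1%N].

Definition shidoku : {set array} :=
  [set B : array | [&& [forall i, each_once B (row_cells i)],
                       [forall j, each_once B (column_cells j)]
                     & [forall a, forall b, each_once B (block_cells a b)]]].

(* The value in cell i moves to cell x i, i.e. (move B x) (x i) = B i.        *)
Definition move (B : array) (x : 'S_16) : array := [ffun j => B (x^-1 j)].

Definition relabel (B : array) (s : 'S_4) : array := [ffun i => s (B i)].

Lemma move_is_action : is_action [set: 'S_16] move.
Proof.
apply: is_total_action => [B | B x y]; apply/ffunP=> j; rewrite !ffunE.
  by rewrite invg1 perm1.
by rewrite invMg permM.
Qed.
Canonical move_action := Action move_is_action.

Definition sym_act (B : array) (g : 'S_16 * 'S_4) : array :=
  relabel (move B g.1) g.2.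

Lemma sym_act_is_action : is_action [set: 'S_16 * 'S_4] sym_act.
Proof.
apply: is_total_action => [B | B x y]; apply/ffunP=> j; rewrite !ffunE /=.
  by rewrite invg1 !perm1.
by rewrite invMg !permM.
Qed.
Canonical sym_action := Action sym_act_is_action.

(* 'N(S | to) is the set of all x such that to B x \in S for all B \in S.     *)
Definition H4 : {group 'S_16} := 'N(shidoku | move_action)%G.

Definition G4 : {group 'S_16 * 'S_4} := setX_group H4 [set: 'S_4]%G.

Definition complete (G : {group 'S_16 * 'S_4}) : bool :=
  orbit sym_action G @: shidoku == orbit sym_action G4 @: shidoku.

(* Main.v *)
(** The product of the quarter turn [r] and the row swap [s] is a cell
    permutation [x] of order 8.  Up to relabelling there are 12 boards, and
    [<x>] permutes them in two cycles, of lengths 4 and 8; as relabelling acts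
    freely, [<x> * S_4] has order 192, two orbits on boards, and acts freely on
    the larger one.  The two orbits are not fused by [G_4], since the number of
    cells where two boards agree is invariant: a board of Type 1 agrees with
    any other board in an even number of cells, a board of Type 2 does not.
    Every complete group has an orbit with 192 elements, hence at least 192
    elements. *)

Require Import Defs.
From mathcomp Require Import all_boot all_fingroup cyclic.

Set Implicit Arguments.
Unset Strict Implicit.
Unset Printing Implicit Defensive.

Local Open Scope group_scope.

(** * Boards as proper colourings, and their enumeration *)

Lemma all_iota_ord n (P : pred nat) :
  all P (iota 0 n) -> forall k : 'I_n, P k.
Proof. by move=> /allP PP k; apply: PP; rewrite mem_iota ltn_ord. Qed.

Lemma all2_iota_ord m n (P : nat -> nat -> bool) :
  all (fun j => all (P j) (iota 0 n)) (iota 0 m) ->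
  forall (j : 'I_m) (k : 'I_n), P j k.
Proof. by move=> PP j; apply: all_iota_ord; apply: (all_iota_ord PP). Qed.

Lemma card_nat_set n (P : pred nat) : #|[set k : 'I_n | P k]| = count P (iota 0 n).
Proof. by rewrite cardsE cardE size_filter -enumT -val_enum_ord count_map. Qed.

(** With four cells and four symbols, an injective filling of [U] is also surjective, by
    counting. *)
Lemma each_onceP (B : array) (U : {set cell}) :
  #|U| = 4 -> reflect {in U &, injective B} (each_once B U).
Proof.
move=> cU; apply: (iffP forallP) => [once j k jU kU Bjk | injB v].
  have /cards1P[a Ea] := once (B j).
  have : j \in [set k in U | B k == B j] by rewrite inE jU eqxx.
  have : k \in [set k in U | B k == B j] by rewrite inE kU Bjk eqxx.
  by rewrite Ea !inE => /eqP-> /eqP->.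
have BU : B @: U = setT.
  by apply/eqP; rewrite eqEcard subsetT cardsT card_ord card_in_imset ?cU.
have /imsetP[j jU ->] : v \in B @: U by rewrite BU inE.
apply/cards1P; exists j; apply/setP => k; rewrite !inE.
by apply/andP/eqP => [[kU /eqP /injB->] // | ->].
Qed.

Lemma card_row i : #|row_cells i| = 4.
Proof.
rewrite (card_nat_set 16 (fun k => k %/ 4 == i)).
by case: i => -[|[|[|[|]]]].
Qed.

Lemma card_column j : #|column_cells j| = 4.
Proof.
rewrite (card_nat_set 16 (fun k => k %% 4 == j)).
by case: j => -[|[|[|[|]]]].
Qed.

Lemma card_block a b : #|block_cells a b| = 4.
Proof.
rewrite (card_nat_set 16 (fun k => (k %/ 4 %/ 2 == a) && (k %% 4 %/ 2 == b))).
by case: a b => -[|[|[]]] // ltia -[[|[|[]]]].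
Qed.

(** Edges of the graph whose proper 4-colourings are the boards, taken over [nat] so that they can
    be evaluated. *)
Definition adjacent (j k : nat) : bool :=
  (j != k) && [|| j %/ 4 == k %/ 4, j %% 4 == k %% 4
    | (j %/ 4 %/ 2 == k %/ 4 %/ 2) && (j %% 4 %/ 2 == k %% 4 %/ 2)].

Lemma shidokuP (B : array) :
  reflect (forall j k : cell, adjacent j k -> B j != B k) (B \in shidoku).
Proof.
rewrite inE; apply: (iffP and3P) => [[/forallP rowB /forallP colB /forallP blkB] j k | properB].
  case/andP=> neq_jk /or3P[jk | jk | /andP[jk1 jk2]]; apply: contraNneq neq_jk => Bjk.
  - have i4 : j %/ 4 < 4 by rewrite ltn_divLR.
    have /each_onceP-/(_ (card_row _))injB := rowB (Ordinal i4).
    by apply/eqP/congr1/injB; rewrite ?inE 1?eq_sym.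
  - have i4 : j %% 4 < 4 by rewrite ltn_mod.
    have /each_onceP-/(_ (card_column _))injB := colB (Ordinal i4).
    by apply/eqP/congr1/injB; rewrite ?inE 1?eq_sym.
  - have a2 : j %/ 4 %/ 2 < 2 by rewrite !ltn_divLR.
    have b2 : j %% 4 %/ 2 < 2 by rewrite ltn_divLR ?ltn_mod.
    have /forallP/(_ (Ordinal b2))/each_onceP-/(_ (card_block _ _))injB := blkB (Ordinal a2).
    by apply/eqP/congr1/injB; rewrite ?inE /= ?eqxx // -(eqP jk1) -(eqP jk2) !eqxx.
have inj_unit (U : {set cell}) :
    {in U &, forall j k : cell, j != k -> adjacent j k} -> {in U &, injective B}.
  move=> adjU j k jU kU /eqP; apply: contraTeq => /(adjU j k jU kU); exact: properB.
split.
- apply/forallP=> i; apply/each_onceP; first exact: card_row.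
  apply: inj_unit => j k; rewrite !inE /adjacent => /eqP-> /eqP-> jk.
  by rewrite eqxx andbT.
- apply/forallP=> i; apply/each_onceP; first exact: card_column.
  apply: inj_unit => j k; rewrite !inE /adjacent => /eqP-> /eqP-> jk.
  by rewrite eqxx !orbT andbT.
- apply/'forall_forallP=> a b; apply/each_onceP; first exact: card_block.
  apply: inj_unit => j k; rewrite !inE /adjacent => /andP[/eqP-> /eqP->] /andP[/eqP-> /eqP->] jk.
  by rewrite !eqxx !orbT andbT.
Qed.

(** Backtracking in reading order: cell [m] takes any symbol absent from its earlier neighbours. *)
Fixpoint boards (n : nat) : seq (seq nat) :=
  if n is m.+1 then
    [seq rcons c v | c <- boards m,
       v <- [seq v <- iota 0 4 | all (fun j => adjacent j m ==> (nth 0 c j != v)) (iota 0 m)]]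
  else [:: [::]].

Definition code (B : array) : seq nat := mkseq (fun k => nat_of_ord (B (inord k))) 16.

Lemma nth_code B (k : cell) : nth 0 (code B) k = B k.
Proof. by rewrite nth_mkseq // inord_val. Qed.

Lemma code_in_boards B : B \in shidoku -> code B \in boards 16.
Proof.
move/shidokuP => properB; rewrite /code.
suff prefix n : n <= 16 -> mkseq (fun k => nat_of_ord (B (inord k))) n \in boards n by exact: prefix.
elim: n => [|n IHn] lt_n; first by rewrite inE.
rewrite mkseqS; apply: allpairs_f_dep; first exact/IHn/ltnW.
rewrite mem_filter mem_iota /= ltn_ord andbT; apply/allP => j.
rewrite mem_iota => /= lt_jn; apply/implyP => adj_jn.
rewrite nth_mkseq //; apply: properB.
by rewrite !inordK // (ltn_trans lt_jn).
Qed.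

Definition decode (c : seq nat) : array := [ffun k : cell => inord (nth 0 c k)].

(** The bound 4 keeps [inord] in [decode] from falling back on its default value. *)
Definition is_code (c : seq nat) : bool :=
  all (fun j => (nth 0 c j < 4) &&
    all (fun k => adjacent j k ==> (nth 0 c j != nth 0 c k)) (iota 0 16)) (iota 0 16).

Lemma val_decode c (k : cell) : is_code c -> decode c k = nth 0 c k :> nat.
Proof. by move/all_iota_ord/(_ k)/andP=> [lt4 _]; rewrite ffunE inordK. Qed.

Lemma decodeK c : size c = 16 -> is_code c -> code (decode c) = c.
Proof.
move=> size_c cc; apply: (@eq_from_nth _ 0) => [|k]; rewrite size_mkseq // => k16.
by rewrite -[k]/(val (Ordinal k16)) nth_code val_decode.
Qed.

Lemma decode_shidoku c : is_code c -> decode c \in shidoku.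
Proof.
move=> cc; apply/shidokuP=> j k adj_jk; rewrite -val_eqE /= !val_decode //.
by have /all_iota_ord/(_ j)/andP[_ /all_iota_ord/(_ k)/implyP->] := cc.
Qed.

(** * The group generated by a cell permutation of order 8 and the relabellings *)

(* The composite of the quarter turn with the swap of the last two rows. *)
Definition turn (k : nat) : nat :=
  nth 0 [:: 3; 7; 15; 11; 2; 6; 14; 10; 1; 5; 13; 9; 0; 4; 12; 8]%N k.

Lemma turn_ord (k : cell) : turn k < 16.
Proof. exact: (@all_iota_ord 16 (fun k => turn k < 16)). Qed.

Lemma turn_inj : injective (fun k : cell => Ordinal (turn_ord k)).
Proof.
move=> j k /(congr1 val)/= /eqP; apply: contraTeq; rewrite -val_eqE.
exact/implyP/(@all2_iota_ord 16 16 (fun j k => (j != k) ==> (turn j != turn k))).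
Qed.

Definition x : 'S_16 := perm turn_inj.

Lemma x_expE n (k : cell) : (x ^+ n) k = iter n turn k :> nat.
Proof. by rewrite permX; elim: n => //= n IHn; rewrite permE /= IHn. Qed.

(** The eighth iterate of [turn] fixes every cell, while the fourth sends cell 0 to cell 5; so the
    order divides 8 but not 4. *)
Lemma order_x : #[x] = 8.
Proof.
have x8 : #[x] %| 2 ^ 3.
  rewrite order_dvdn; apply/eqP/permP=> k; apply/val_inj/eqP.
  rewrite /= x_expE perm1; exact: (@all_iota_ord 16 (fun k => iter 8 turn k == k)).
have x4 : ~~ (#[x] %| 2 ^ 2).
  rewrite order_dvdn; apply: contraTN isT => /eqP/permP/(_ ord0)/(congr1 val).
  by rewrite /= x_expE perm1.
have /(@dvdn_pfactor 2 _ 3 isT)[n le_n3 xn] := x8.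
by move: x4; rewrite xn; move: n le_n3 {xn} => [|[|[|[|]]]].
Qed.

Lemma x_H4 : x \in H4.
Proof.
rewrite inE; apply/andP; split; first by rewrite inE.
rewrite inE; apply/subsetP=> B /shidokuP properB; rewrite inE; apply/shidokuP=> j k.
(* Writing [j] and [k] as images under [x] turns the claim about the inverse of [x] into a check on
   the table [turn]. *)
rewrite -{1}(permKV x j) -{1}(permKV x k) !ffunE => adj_jk; apply: properB.
move: adj_jk; rewrite !permE /=.
exact/implyP/(@all2_iota_ord 16 16 (fun j k => adjacent (turn j) (turn k) ==> adjacent j k)).
Qed.

Lemma relabel_shidoku B s : B \in shidoku -> relabel B s \in shidoku.
Proof.
move/shidokuP=> properB; apply/shidokuP=> j k /properB.
by rewrite !ffunE (inj_eq perm_inj).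
Qed.

Lemma G4_act B g : g \in G4 -> B \in shidoku -> sym_act B g \in shidoku.
Proof.
by case: g => y s /setXP[/= yH4 _] BS; rewrite relabel_shidoku //= (astabs_act _ yH4).
Qed.

Definition K : {group 'S_16 * 'S_4} := setX_group <[x]>%G [set: 'S_4]%G.

Lemma card_K : #|K| = 192.
Proof. by rewrite cardsX -orderE order_x cardsT card_Sn. Qed.

Lemma K_sub_G4 : K \subset G4.
Proof. by rewrite setXS // cycle_subG x_H4. Qed.

(** * Boards up to relabelling *)

(** A canonical form up to relabelling: each symbol becomes the position of its first occurrence,
    which records exactly the partition of the cells by symbol. *)
Definition pattern (c : seq nat) : seq nat := [seq index v c | v <- c].

Lemma nth_pattern_eq c j k : j < size c -> k < size c ->
  (nth 0 (pattern c) j == nth 0 (pattern c) k) = (nth 0 c j == nth 0 c k).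
Proof.
move=> jc kc; rewrite !(nth_map 0) //; apply/eqP/eqP => [|-> //].
by move/(congr1 (nth 0 c)); rewrite !nth_index ?mem_nth.
Qed.

Lemma relabel_pattern B C : B \in shidoku -> pattern (code B) = pattern (code C) ->
  exists s, relabel B s = C.
Proof.
move=> BS BC.
have eqBC j k : (B j == B k) = (C j == C k).
  have eq_code (D : array) : (D j == D k) = (nth 0 (pattern (code D)) j == nth 0 (pattern (code D)) k).
    by rewrite nth_pattern_eq ?size_mkseq // !nth_code.
  by rewrite !eq_code BC.
have surjB v : exists k, B k == v.
  move: BS; rewrite inE => /and3P[/forallP/(_ ord0)/forallP/(_ v)/cards1P[k Bv] _ _].
  by exists k; move/setP/(_ k): Bv; rewrite !inE eqxx => /andP[].
(* The choice of a cell showing [v] is immaterial: by [eqBC], [C] is constant on such cells, and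
   differs on cells where [B] differs. *)
pose f v := C (xchoose (surjB v)).
have f_inj : injective f.
  move=> v w /eqP; rewrite -eqBC => /eqP.
  by rewrite (eqP (xchooseP (surjB v))) (eqP (xchooseP (surjB w))).
exists (perm f_inj); apply/ffunP=> k; rewrite ffunE permE; apply/eqP.
by rewrite -eqBC (xchooseP (surjB (B k))).
Qed.

(** The effect of [x ^- i]: since [move] reads a board through the inverse, cell [k] is looked up at
    a forward iterate of [turn]. *)
Definition spin (b : seq nat) (i : nat) : seq nat :=
  mkseq (fun k => nth 0 b (iter i turn k)) 16.

Lemma code_spin b i : is_code b -> code (move (decode b) (x ^- i)) = spin b i.
Proof.
move=> cb; apply: (@eq_from_nth _ 0) => [|k]; rewrite ?size_mkseq // => k16.
by rewrite -[k]/(val (Ordinal k16)) nth_code ffunE invgK val_decode // x_expE nth_mkseq.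
Qed.

Definition type1 := [:: 0; 1; 2; 3; 2; 3; 0; 1; 1; 0; 3; 2; 3; 2; 1; 0]%N.
Definition type2 := [:: 0; 1; 2; 3; 2; 3; 0; 1; 1; 2; 3; 0; 3; 0; 1; 2]%N.

(** An exhaustive evaluation over the enumerated boards; it yields that [K] has at most two
    orbits. *)
Lemma boards_cover :
  all (mem [seq pattern (spin b i) | b <- [:: type1; type2], i <- iota 0 8])
      [seq pattern c | c <- boards 16].
Proof. by vm_compute. Qed.

Lemma orbit_cover B : B \in shidoku ->
  exists2 b, b \in [:: type1; type2] & B \in orbit sym_action K (decode b).
Proof.
move=> BS.
have /(allP boards_cover)/allpairsP[[b i] /= [b12 _ Bbi]] := map_f pattern (code_in_boards BS).
exists b => //.
have cb : is_code b by move: b b12 {Bbi}; apply/allP.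
rewrite -(code_spin i cb) in Bbi.
have xi : x ^- i \in <[x]> by rewrite groupV mem_cycle.
have yS : move (decode b) (x ^- i) \in shidoku.
  have xH4 : x ^- i \in H4 by rewrite groupV groupX // x_H4.
  by rewrite (astabs_act _ xH4) decode_shidoku.
have [s Bs] := relabel_pattern yS (esym Bbi).
by apply/orbitP; exists (x ^- i, s) => //; apply/setXP; rewrite inE.
Qed.

(** Relabelling preserves which pairs of cells show equal symbols, so one distinguishing pair shows
    that no relabelling can undo [i] turns. *)
Lemma spin_type2_rigid :
  all (fun i => (i != 0) ==> has (fun j => has (fun k =>
      (nth 0 (spin type2 i) j == nth 0 (spin type2 i) k) != (nth 0 type2 j == nth 0 type2 k))
    (iota 0 16)) (iota 0 16)) (iota 0 8).
Proof. by vm_compute. Qed.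

Lemma orbit_type2 : #|orbit sym_action K (decode type2)| = 192.
Proof.
have c2 : is_code type2 by vm_compute.
suff stab1 : 'C_K[decode type2 | sym_action] = 1.
  by rewrite card_orbit stab1 indexg1 card_K.
apply/trivgP/subsetP=> -[y s] /setIP[/setXP[/= yK _] /astab1P /ffunP fixB].
have [i i8 yi] : exists2 i, i < 8 & y = x ^- i.
  have /cyclePmin[i i8 yi] : y^-1 \in <[x]> by rewrite groupV.
  by exists i; rewrite -?order_x // -yi invgK.
have {}fixB k : s (move (decode type2) (x ^- i) k) = decode type2 k.
  by rewrite -yi -[RHS]fixB [in RHS]ffunE.
have i0 : i = 0.
  apply/eqP; have /allP/(_ i) := spin_type2_rigid; rewrite mem_iota => /(_ i8).
  apply: contraTT => ->; rewrite implyTb; apply/hasPn => j; rewrite mem_iota => j16.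
  apply/hasPn => k; rewrite mem_iota => k16; rewrite negbK.
  rewrite -[j]/(val (Ordinal (j16 : j < 16))) -[k]/(val (Ordinal (k16 : k < 16))) -code_spin // !nth_code.
  rewrite -!(val_decode _ c2) !val_eqE.
  by rewrite -[decode _ (Ordinal j16)]fixB -[decode _ (Ordinal k16)]fixB (inj_eq perm_inj).
rewrite i0 expg0 invg1 in yi fixB; rewrite yi in_set1; apply/eqP; congr pair.
apply/permP=> v; rewrite perm1.
(* The first row of [type2] is 0, 1, 2, 3, so the cell numbered [v] shows the symbol [v], and [s]
   must fix it. *)
have v16 : v < 16 by rewrite (ltn_trans (ltn_ord v)).
have Bv : decode type2 (Ordinal v16) = v.
  by apply: val_inj; rewrite /= val_decode //=; case: v {v16} => -[|[|[|[|]]]].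
by have := fixB (Ordinal v16); rewrite ffunE invg1 perm1 Bv.
Qed.

(** * Agreement of boards *)

Definition agreement (B C : array) : nat := #|[set k | B k == C k]|.

Lemma agreement_act B C g : agreement (sym_act B g) (sym_act C g) = agreement B C.
Proof.
rewrite /agreement -[RHS](card_preimset _ (@perm_inj _ g.1^-1)); apply: eq_card => k.
by rewrite !inE !ffunE (inj_eq perm_inj).
Qed.

Definition agreement_code (b c : seq nat) : nat :=
  count (fun k => nth 0 b k == nth 0 c k) (iota 0 16).

Lemma agreement_decode b C :
  is_code b -> agreement (decode b) C = agreement_code b (code C).
Proof.
move=> cb; rewrite /agreement_code -card_nat_set; apply: eq_card => k.
by rewrite !inE nth_code -val_decode.
Qed.

Lemma type1_even : all (fun c => ~~ odd (agreement_code type1 c)) (boards 16).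
Proof. by vm_compute. Qed.

Lemma type2_notin_orbit_type1 : decode type2 \notin orbit sym_action G4 (decode type1).
Proof.
apply/negP=> /orbitP[g gG4 /= gB].
(* This board agrees with [type2] in 9 cells; pulled back by [g], it would agree with [type1] in 9
   cells too. *)
pose D := decode [:: 0; 1; 2; 3; 2; 3; 1; 0; 1; 0; 3; 2; 3; 2; 0; 1]%N.
have DS : D \in shidoku by apply: decode_shidoku; vm_compute.
have odd2 : odd (agreement (decode type2) D).
  by rewrite agreement_decode ?decodeK //; vm_compute.
have gDS : sym_act D g^-1 \in shidoku by rewrite G4_act ?groupV.
move: (allP type1_even _ (code_in_boards gDS)); rewrite -agreement_decode; last by vm_compute.
by rewrite -(agreement_act _ _ g) gB (actKV sym_action) odd2.
Qed.

(** * Complete groups *)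

Lemma complete_orbitP (G : {group 'S_16 * 'S_4}) : G \subset G4 ->
  reflect {in shidoku, forall B, orbit sym_action G B = orbit sym_action G4 B} (complete G).
Proof.
move=> GG4; apply: (iffP eqP) => [orbG B BS | orbG]; last exact: eq_in_imset.
have /imsetP[C CS eqC] : orbit sym_action G B \in orbit sym_action G4 @: shidoku.
  by rewrite -orbG imset_f.
by rewrite eqC; apply/orbit_eqP; rewrite orbit_sym -eqC orbit_refl.
Qed.

Lemma complete_K : complete K.
Proof.
apply/(complete_orbitP K_sub_G4)=> B BS; apply/eqP; rewrite eqEsubset imsetS ?K_sub_G4 //=.
apply/subsetP=> C BC; have CS : C \in shidoku by case/orbitP: BC => g gG4 <-; apply: G4_act.
have KG4 D D' : D \in orbit sym_action K D' -> D \in orbit sym_action G4 D'.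
  by apply/subsetP/imsetS/K_sub_G4.
have [b b12 Bb] := orbit_cover BS; have [c c12 Cc] := orbit_cover CS.
have cb : decode c \in orbit sym_action G4 (decode b).
  apply: (orbit_trans _ (KG4 _ _ Bb)); apply: (orbit_trans _ BC).
  by rewrite orbit_sym KG4.
(* [B] and [C] lie in one [G4]-orbit, and the two representatives are not fused by [G4]. *)
have Ebc : b = c.
  move: b12 c12 cb; rewrite !inE => /orP[]/eqP-> /orP[]/eqP-> //.
    by rewrite (negPf type2_notin_orbit_type1).
  by rewrite orbit_sym (negPf type2_notin_orbit_type1).
by rewrite (orbit_trans Cc) // -Ebc orbit_sym.
Qed.

Theorem theorem1 :
  (exists G : {group 'S_16 * 'S_4},
      [/\ G \subset G4, complete G & #|G| = 192]) /\
  (forall G : {group 'S_16 * 'S_4},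
      G \subset G4 -> complete G -> 192 <= #|G|).
Proof.
split=> [|G GG4 /(complete_orbitP GG4) orbG].
  by exists K; rewrite K_sub_G4 complete_K card_K.
have S2 : decode type2 \in shidoku by apply: decode_shidoku; vm_compute.
(* The [G]-orbit of [type2] is an image of [G]; by completeness it is the [G4]-orbit, which contains
   the [K]-orbit of size 192. *)
rewrite -orbit_type2 (leq_trans _ (leq_imset_card (sym_act (decode type2)) G)) //.
by rewrite subset_leq_card // -/(orbit sym_action G _) orbG // imsetS // K_sub_G4.
Qed.
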